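(* For each pair $(\ell,\mu)\in\{(96,8),(120,8),(128,8)\}$ there exist an even unimodular lattice $U$, a polarization $M,N$ of $\Upsilon=\frac1{\sqrt2}U$ and an integer $k\ge2$ such that $L(M,N,k)$ is an even unimodular lattice of rank $\ell$ with minimum norm $\mu$.
   Context: All lattices are positive definite rational lattices; the minimum norm of a lattice $X$ is $\min\{(x,x):x\in X,x\ne0\}$. For $U$ even integral unimodular and $\Upsilon=\frac1{\sqrt2}U$, a polarization of $\Upsilon$ is a pair of integral sublattices $M,N\subseteq\Upsilon$ with $M+N=\Upsilon$ and $M\cap N=2\Upsilon$. For $k\ge2$, inside the orthogonal direct sum $\Upsilon^k$, $L_M=\{(x_1,\dots,x_k)\in M^k: x_1+\cdots+x_k\in M\cap N\}$, $L^N=\{(y,\dots,y):y\in N\}$ and $L(M,N,k)=L_M+L^N$. *)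

(* Defs.v *)
From HB Require Import structures.
From mathcomp Require Import all_boot all_order all_algebra.
From mathcomp Require Import boolp classical_sets reals.

Set Implicit Arguments.
Unset Strict Implicit.
Unset Printing Implicit Defensive.
Import Order.TTheory GRing.Theory Num.Theory.
Local Open Scope classical_set_scope.
Local Open Scope ring_scope.

(* Lattices are realized inside Euclidean spaces 'M[R]_(m, n), equipped with
   the entrywise inner product. R^n is 'rV[R]_n, and the orthogonal direct sum
   (R^n)^k is 'M[R]_(k, n): the k-tuple (x_1, ..., x_k) has rows x_1, ..., x_k.
   Positive definiteness is then automatic. *)

Section Lattices.
Variables (R : realType) (m n : nat).
Implicit Types (L : set 'M[R]_(m, n)) (x y : 'M[R]_(m, n)).

Definition inner x y : R := \sum_(i < m) \sum_(j < n) x i j * y i j.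

Definition Zspan (r : nat) (b : r.-tuple 'M[R]_(m, n)) : set 'M[R]_(m, n) :=
  [set x | exists c : 'I_r -> int, x = \sum_(i < r) tnth b i *~ c i].

Definition rational_form L : Prop :=
  forall x y, L x -> L y -> exists q : rat, inner x y = ratr q.

Definition lattice_of_rank (r : nat) L : Prop :=
  (exists b : r.-tuple 'M[R]_(m, n), free b /\ L = Zspan b) /\ rational_form L.

Definition lattice L : Prop := exists r, lattice_of_rank r L.

Definition integral L : Prop :=
  forall x y, L x -> L y -> inner x y \is a Num.int.

Definition even L : Prop :=
  forall x, L x -> exists z : int, inner x x = (2 * z)%:~R.

(* The first condition says that x lies in the rational span of L. *)
Definition dual L : set 'M[R]_(m, n) :=
  [set x | (exists2 d : nat, (0 < d)%N & L (x *+ d)) /\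
           forall y, L y -> inner x y \is a Num.int].

Definition unimodular L : Prop := dual L = L.

Definition even_unimodular_of_rank (r : nat) L : Prop :=
  [/\ lattice_of_rank r L, integral L, even L & unimodular L].

Definition even_unimodular L : Prop := exists r, even_unimodular_of_rank r L.

Definition has_min_norm L (mu : R) : Prop :=
  (exists x, [/\ L x, x != 0 & inner x x = mu]) /\
  (forall x, L x -> x != 0 -> mu <= inner x x).

Definition scale (a : R) L : set 'M[R]_(m, n) := [set a *: x | x in L].

Definition sumset (A B : set 'M[R]_(m, n)) : set 'M[R]_(m, n) :=
  [set x + y | x in A & y in B].

Definition integral_sublattice M L : Prop :=
  [/\ lattice M, M `<=` L & integral M].

Definition polarization (Upsilon M N : set 'M[R]_(m, n)) : Prop :=
  [/\ integral_sublattice M Upsilon, integral_sublattice N Upsilon,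
      sumset M N = Upsilon & M `&` N = scale 2 Upsilon].

End Lattices.

Section Construction.
Variables (R : realType) (n : nat).
Implicit Types (M N : set 'rV[R]_n).

Definition lower_part M N (k : nat) : set 'M[R]_(k, n) :=
  [set X | (forall i, M (row i X)) /\ (M `&` N) (\sum_(i < k) row i X)].

Definition diagonal_part N (k : nat) : set 'M[R]_(k, n) :=
  [set X | exists2 y, N y & forall i, row i X = y].

Arguments lower_part M N k _ : clear implicits.
Arguments diagonal_part N k _ : clear implicits.

Definition polarized_lattice M N (k : nat) : set 'M[R]_(k, n) :=
  sumset (lower_part M N k) (diagonal_part N k).

End Construction.

Arguments lower_part {R n} M N k _.
Arguments diagonal_part {R n} N k _.
Arguments polarized_lattice {R n} M N k _.

(* Main.v *)
(* Multiplication by alpha = (1 + sqrt -7) / 2 doubles norms, and alpha times its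
   conjugate is 2. If alpha acts on an even unimodular U, with conjugate as
   adjoint, then M = alpha Y and N = conj(alpha) Y, Y = U / sqrt 2, are isometric
   to U and form a polarization of Y: M + N = Y as alpha + conj(alpha) = 1.
   When U has minimum mu and k mu > 4 mu - 4, L(M,N,k) has minimum 2 mu; the
   action of alpha on each coordinate preserves it, so the construction iterates.
   From E8, with alpha given by a skew conference matrix of order 8, one gets
   lattices of minimum 4 in dimensions 24 = 3 * 8 and 32 = 4 * 8, and then of
   minimum 8 in dimensions 96 = 4 * 24, 120 = 5 * 24 and 128 = 4 * 32. *)

Require Import Defs.
From HB Require Import structures.
From mathcomp Require Import all_boot all_order all_algebra.
From mathcomp Require Import boolp classical_sets reals.
From mathcomp Require Import ring lra zify.

Set Implicit Arguments.
Unset Strict Implicit.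
Unset Printing Implicit Defensive.
Import Order.TTheory GRing.Theory Num.Theory.
Local Open Scope classical_set_scope.
Local Open Scope ring_scope.

(** * Subgroups of abelian groups, and bases of subgroups of Z^N *)

Section Subgroups.
Variable V : zmodType.

Definition is_subgroup (L : set V) : Prop :=
  L 0 /\ forall x y, L x -> L y -> L (x - y).

Variables (L : set V) (hL : is_subgroup L).

Lemma is_subgroupN x : L x -> L (- x).
Proof. by move=> Lx; rewrite -sub0r; apply: hL.2 => //; exact: hL.1. Qed.

Lemma is_subgroupD x y : L x -> L y -> L (x + y).
Proof. by move=> Lx Ly; rewrite -[y]opprK; apply: hL.2 => //; apply: is_subgroupN. Qed.

Lemma is_subgroup_muln x n : L x -> L (x *+ n).
Proof.
move=> Lx; elim: n => [|n IHn]; first by rewrite mulr0n; exact: hL.1.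
by rewrite mulrS; apply: is_subgroupD.
Qed.

Lemma is_subgroup_mulz x z : L x -> L (x *~ z).
Proof.
move=> Lx; case: z => n; first exact: is_subgroup_muln.
by apply: is_subgroupN; apply: is_subgroup_muln.
Qed.

Lemma is_subgroup_sum (I : finType) (F : I -> V) :
  (forall i, L (F i)) -> L (\sum_i F i).
Proof.
by move=> LF; apply: (big_ind L) => //; [exact: hL.1 | exact: is_subgroupD].
Qed.

End Subgroups.

Lemma lsubmx_row1 (S : nzRingType) N (z : 'rV[S]_(1 + N)) :
  lsubmx z = (z 0 0)%:M.
Proof.
by rewrite [LHS]mx11_scalar mxE; congr (z _ _)%:M; apply/val_inj.
Qed.

(* Hermite normal form: the first coordinates of L form an ideal of Z, the
   vectors with first coordinate 0 a subgroup of Z^(N-1). *)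
Lemma subgroup_int_basis N (L : set 'rV[int]_N) (d : int) :
    is_subgroup L -> 0 < d -> (forall x, L (d *: x)) ->
  exists2 B : 'M[int]_N, \det B != 0 & L = [set c *m B | c in setT].
Proof.
elim: N L => [|N IHN] L hL d_gt0 dL.
  exists 1%:M; first by rewrite det1.
  apply/seteqP; split=> [x Lx | _ [c _ <-]]; first by exists x; rewrite ?mulmx1.
  by rewrite [c *m _](_ : _ = 0); [exact: hL.1 | apply/rowP; case].
(* [n.+1] will be the least positive first coordinate occurring in [L]; the vector with all entries
   [d] shows that there is one. *)
have exn : exists n : nat, `[< exists2 x, L x & x 0 0 = n.+1%:Z >].
  exists `|d|.-1%N; apply/asboolP; exists (d *: const_mx 1) => //.
  by rewrite !mxE mulr1 prednK ?absz_gt0 ?gt_eqF // gez0_abs // ltW.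
case: (ex_minnP exn) => n /asboolP[v Lv v0] n_min.
pose L' : set 'rV[int]_N := [set y | L (row_mx (0 : 'rV_1) y)].
have hL' : is_subgroup L'.
  split; first by rewrite /L' /= row_mx0; exact: hL.1.
  move=> x y Lx Ly; rewrite /L' /=.
  have -> : row_mx (0 : 'rV_1) (x - y) = row_mx (0 : 'rV_1) x - row_mx 0 y.
    by rewrite opp_row_mx add_row_mx oppr0 addr0.
  exact: hL.2.
have [|B' detB' defL'] := IHN L' hL' d_gt0.
  move=> x; rewrite /L' /=.
  have -> : row_mx (0 : 'rV_1) (d *: x) = d *: row_mx (0 : 'rV_1) x.
    by rewrite scale_row_mx scaler0.
  exact: dL.
have [vr defv] : exists vr, v = row_mx (n.+1%:Z)%:M vr :> 'rV_(1 + N).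
  by exists (rsubmx (v : 'rV_(1 + N))); rewrite -[LHS](@hsubmxK _ 1 1 N)
    lsubmx_row1 v0.
(* Block triangular basis: [v] on top, then the basis [B'] of the vectors with first coordinate
   0. *)
exists (block_mx (n.+1%:Z)%:M vr 0 B').
  by rewrite (@det_ublock _ 1 N) mulf_neq0 // det_scalar1.
have mulB (a : int) c :
    row_mx (a%:M : 'M_1) c *m block_mx (n.+1%:Z)%:M vr 0 B'
    = v *~ a + row_mx (0 : 'rV_1) (c *m B') :> 'rV[int]_(1 + N).
  rewrite mul_row_block mulmx0 addr0 !mul_scalar_mx defv -scaler_int intz.
  rewrite (_ : _ *: row_mx _ _ = row_mx (a *: (n.+1%:Z)%:M) (a *: vr)).
    by apply: etrans (esym (add_row_mx _ _ _ _)); rewrite addr0.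
  exact: scale_row_mx.
apply/seteqP; split=> [x Lx | _ [c _ <-]]; last first.
  rewrite -[c](@hsubmxK _ 1 1 N) lsubmx_row1 mulB.
  apply: is_subgroupD => //; first exact: is_subgroup_mulz.
  have : L' (rsubmx (c : 'rV_(1 + N)) *m B') by rewrite defL'; eexists.
  by [].
(* Euclidean division: the first coordinate of [y] is a remainder modulo [n.+1], so minimality of
   [n] forces it to vanish. *)
pose q := divz (x 0 0) n.+1%:Z; pose y := x - v *~ q.
have Ly : L y by apply: hL.2 => //; apply: is_subgroup_mulz.
have y0 : y 0 0 = 0.
  have y0E : y 0 0 = modz (x 0 0) n.+1%:Z.
    by rewrite /y /modz -/q -scaler_int intz !mxE v0.
  have : 0 <= y 0 0 < n.+1%:Z by rewrite y0E modz_ge0 // ltz_pmod.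
  case yE: (y 0 0) => [[//|m]|//] /andP[_ ltmn].
  have : (n <= m)%N by apply: n_min; apply/asboolP; exists y.
  by rewrite leqNgt -ltnS -ltz_nat ltmn.
have yE : y = row_mx (0 : 'rV_1) (rsubmx (y : 'rV_(1 + N))).
  rewrite -[LHS](@hsubmxK _ 1 1 N) lsubmx_row1 y0.
  by rewrite [0%:M]raddf0.
have : L' (rsubmx (y : 'rV_(1 + N))) by rewrite /L' /= -yE.
rewrite defL' => -[c _ defc].
exists (row_mx (q%:M : 'M_1) c) => //.
by rewrite mulB defc -yE addrC subrK.
Qed.

(** * The entrywise inner product *)

Section InnerProduct.
Variables (R : realType) (m n : nat).
Implicit Types (x y z : 'M[R]_(m, n)).

Lemma inner_mxtrace x y : inner x y = \tr (x *m y^T).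
Proof.
by apply: eq_bigr => i _; rewrite mxE; apply: eq_bigr => j _; rewrite mxE.
Qed.

Lemma innerC x y : inner x y = inner y x.
Proof. by apply: eq_bigr => i _; apply: eq_bigr => j _; rewrite mulrC. Qed.

Lemma innerDl x y z : inner (x + y) z = inner x z + inner y z.
Proof. by rewrite !inner_mxtrace mulmxDl mxtraceD. Qed.

Lemma innerDr x y z : inner z (x + y) = inner z x + inner z y.
Proof. by rewrite innerC innerDl !(innerC z). Qed.

Lemma innerZl a x y : inner (a *: x) y = a * inner x y.
Proof. by rewrite !inner_mxtrace -scalemxAl mxtraceZ. Qed.

Lemma innerZr a x y : inner x (a *: y) = a * inner x y.
Proof. by rewrite innerC innerZl innerC. Qed.

Lemma innerNl x y : inner (- x) y = - inner x y.
Proof. by rewrite -scaleN1r innerZl mulN1r. Qed.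

Lemma innerNr x y : inner x (- y) = - inner x y.
Proof. by rewrite innerC innerNl innerC. Qed.

Lemma inner0r x : inner x 0 = 0.
Proof. by rewrite -(scale0r 0) innerZr mul0r. Qed.

Lemma inner_suml (I : finType) (F : I -> 'M[R]_(m, n)) x :
  inner (\sum_i F i) x = \sum_i inner (F i) x.
Proof.
by elim/big_ind2: _ => [|u a v b <- <-|//]; rewrite ?innerDl // innerC inner0r.
Qed.

Lemma inner_mulmxl x (A : 'M_n) y : inner (x *m A) y = inner x (y *m A^T).
Proof. by rewrite !inner_mxtrace trmx_mul trmxK mulmxA. Qed.

Lemma inner_ge0 x : 0 <= inner x x.
Proof. by do 2!apply: sumr_ge0 => ? _; rewrite -expr2 sqr_ge0. Qed.

Lemma inner_eq0 x : (inner x x == 0) = (x == 0).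
Proof.
apply/eqP/eqP => [x0|->]; last exact: inner0r.
have ge0 i j : 0 <= x i j * x i j by rewrite -expr2 sqr_ge0.
apply/matrixP => i j; rewrite mxE; apply/eqP; rewrite -sqrf_eq0 expr2; apply/eqP.
have {}x0 : \sum_j x i j * x i j = 0.
  by apply: (psumr_eq0P _ x0) => // k _; exact: sumr_ge0.
exact: (psumr_eq0P _ x0).
Qed.

Lemma inner_gt0 x : x != 0 -> 0 < inner x x.
Proof. by move=> x0; rewrite lt_def inner_ge0 inner_eq0 x0. Qed.

End InnerProduct.

Lemma inner_row (R : realType) k n (X Y : 'M[R]_(k, n)) :
  inner X Y = \sum_i inner (row i X) (row i Y).
Proof.
apply: eq_bigr => i _; rewrite /inner big_ord1.
by apply: eq_bigr => j _; rewrite !mxE.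
Qed.

Lemma inner_delta (R : realType) n (v : 'rV[R]_n) i :
  inner (delta_mx 0 i) v = v 0 i.
Proof.
rewrite /inner big_ord1 (bigD1 i) //= mxE !eqxx mul1r big1 ?addr0 // => j ji.
by rewrite mxE (negPf ji) andbF mul0r.
Qed.

Lemma inner_mxvec (R : realType) k n (X Y : 'M[R]_(k, n)) :
  inner (mxvec X) (mxvec Y) = inner X Y.
Proof.
rewrite [LHS]big_ord1 (reindex _ (curry_mxvec_bij k n)) /= /inner pair_bigA /=.
by apply: eq_bigr => -[i j] _; rewrite !mxvecE.
Qed.

(** By the polarization identity, (x, y) is half of an even number. *)
Lemma even_integral (R : realType) m n (L : set 'M[R]_(m, n)) :
  is_subgroup L -> even L -> integral L.
Proof.
move=> hL evL x y Lx Ly.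
have [a xa] := evL x Lx; have [b yb] := evL y Ly.
have [c xyc] := evL (x + y) (is_subgroupD hL Lx Ly).
apply/intrP; exists (c - a - b).
move: xyc; rewrite innerDl !innerDr xa yb (innerC y x) !intrM !rmorphB /= => xyc.
lra.
Qed.

(** * Free lattices of given rank *)

(** A basis encoded as a parametrization: injectivity on all of R^r is real independence, and
    images, direct sums and changes of basis become compositions of maps. *)
Definition free_of_rank (R : realType) m n r (L : set 'M[R]_(m, n)) : Prop :=
  exists f : 'rV[R]_r -> 'M[R]_(m, n),
    [/\ linear f, injective f & L = [set f (map_mx intr c) | c in setT]].

Section FreeOfRank.
Variable R : realType.

Lemma free_of_rank_subgroup m n r (L : set 'M[R]_(m, n)) :
  free_of_rank r L -> is_subgroup L.
Proof.
move=> [f [lf injf ->]].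
pose F : {linear _ -> _} := HB.pack f (GRing.isLinear.Build _ _ _ _ f lf).
have f0 : f 0 = 0 := linear0 F.
have fB : {morph f : x y / x - y} := linearB F.
split=> [|_ _ [c _ <-] [d _ <-]]; first by exists 0; rewrite ?map_mx0 ?f0.
by exists (c - d) => //; rewrite map_mxB fB.
Qed.

Lemma free_of_rank_image m n m' n' r (L : set 'M[R]_(m, n))
    (g : {linear 'M[R]_(m, n) -> 'M[R]_(m', n')}) :
  injective g -> free_of_rank r L -> free_of_rank r [set g x | x in L].
Proof.
move=> injg [f [lf injf ->]]; exists (g \o f); split; last 1 first.
- apply/seteqP; split=> [_ [_ [c _ <-] <-]|_ [c _ <-]]; first by exists c.
  by exists (f (map_mx intr c)) => //; exists c.
- by move=> a x y; rewrite /= lf linearP.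
- exact: inj_comp.
Qed.

Lemma free_of_rank_Zspan m n r (L : set 'M[R]_(m, n)) :
  free_of_rank r L -> exists b : r.-tuple 'M[R]_(m, n), free b /\ L = Zspan b.
Proof.
move=> [f [lf injf ->]].
pose F : {linear _ -> _} := HB.pack f (GRing.isLinear.Build _ _ _ _ f lf).
have f0 : f 0 = 0 := linear0 F.
pose b := [tuple f (delta_mx 0 i) | i < r].
have fE v : f v = \sum_i v 0 i *: b`_i.
  rewrite {1}[v]row_sum_delta [LHS](linear_sum F); apply: eq_bigr => i _.
  by rewrite [LHS](linearZ_LR F) -tnth_nth tnth_mktuple.
exists b; split.
  apply/freeP => k k0 i.
  have : f (\row_j k j) = f 0.
    rewrite f0 -k0 fE; apply: eq_bigr => j _.
    by rewrite mxE.
  by move/injf/rowP => /(_ i); rewrite !mxE.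
apply/seteqP; split=> [_ [c _ <-] | _ [c ->]].
  exists (c 0); rewrite fE; apply: eq_bigr => i _.
  by rewrite mxE scaler_int -tnth_nth.
exists (\row_i c i) => //; rewrite fE; apply: eq_bigr => i _.
by rewrite !mxE scaler_int -tnth_nth.
Qed.

(** Pulled back along [f], [L] becomes a subgroup of Z^r containing d Z^r; it has a nonsingular
    integer basis [B], and [f] precomposed with [B] parametrizes [L]. *)
Lemma free_of_rank_between m n r (L K : set 'M[R]_(m, n)) (d : int) :
    0 < d -> is_subgroup L -> free_of_rank r K ->
    L `<=` K -> (forall x, K x -> L (x *~ d)) ->
  free_of_rank r L.
Proof.
move=> d_gt0 hL [f [lf injf ->]] LK dKL.
pose F : {linear _ -> _} := HB.pack f (GRing.isLinear.Build _ _ _ _ f lf).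
have f0 : f 0 = 0 := linear0 F.
have fB : {morph f : x y / x - y} := linearB F.
pose Lc : set 'rV[int]_r := [set c | L (f (map_mx intr c))].
have [||B detB defLc] := @subgroup_int_basis r Lc d _ d_gt0.
- split; first by rewrite /Lc /= map_mx0 f0; exact: hL.1.
  by move=> x y Lx Ly; rewrite /Lc /= map_mxB fB; apply: hL.2.
- move=> c; rewrite /Lc /= map_mxZ scaler_int [f _](raddfMz F).
  by apply: dKL; exists c.
exists (fun v => f (v *m map_mx intr B)); split.
- by move=> a x y; rewrite mulmxDl -scalemxAl lf.
- move=> x y /injf; apply: (can_inj (mulmxK _)).
  by rewrite unitmxE det_map_mx unitfE intr_eq0.
apply/seteqP; split=> [x Lx | _ [c _ <-]].
  have [c _ defx] := LK x Lx.
  have : Lc c by rewrite /Lc /= defx.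
  by rewrite defLc => -[c' _ defc]; exists c' => //; rewrite -map_mxM defc.
rewrite -map_mxM -[L _]/(Lc (c *m B)) defLc.
by exists c.
Qed.

Lemma free_of_rank_rows k n r (L : set 'rV[R]_n) :
  free_of_rank r L ->
  free_of_rank (k * r) [set X : 'M[R]_(k, n) | forall i, L (row i X)].
Proof.
move=> [f [lf injf ->]].
exists (fun v => \matrix_i f (row i (vec_mx v))); split.
- move=> a x y; apply/row_matrixP => i.
  by rewrite !(linearP, linearD, linearZ) /= !rowK linearD linearZ lf.
- move=> x y /row_matrixP fxy; apply: (can_inj vec_mxK); apply/row_matrixP => i.
  by have := fxy i; rewrite !rowK => /injf.
apply/seteqP; split=> [X LX | _ [c _ <-] i]; last first.
  by rewrite rowK; exists (row i (vec_mx c)) => //; rewrite map_row map_vec_mx.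
have /choice[c cE] : forall i, exists c, f (map_mx intr c) = row i X.
  by move=> i; have [c _ <-] := LX i; exists c.
exists (mxvec (\matrix_i c i)) => //; apply/row_matrixP => i.
by rewrite rowK map_mxvec mxvecK -map_row rowK.
Qed.

End FreeOfRank.

(** * Even self-dual lattices and their isometric copies *)

(* Over all of R^(m x n) the integrality of the pairings already forces x to
   lie in the rational span of L when L has full rank. *)
Record even_selfdual (R : realType) m n (r mu : nat) (L : set 'M[R]_(m, n)) : Prop :=
  EvenSelfdual {
    esd_free : free_of_rank r L;
    esd_even : even L;
    esd_dual : forall x, (forall y, L y -> inner x y \is a Num.int) -> L x;
    esd_min : has_min_norm L mu%:R
  }.

(** Turns evenness into membership in [Num.int], which is closed under sums. *)
Lemma even_numberP (R : realType) (a : R) :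
  (exists z : int, a = (2 * z)%:~R) <-> a / 2 \is a Num.int.
Proof.
split=> [[z ->]|/intrP[z az]].
  by rewrite intrM mulrC mulKf ?intr_int // pnatr_eq0.
by exists z; rewrite intrM -az mulrC divfK // pnatr_eq0.
Qed.

Section EvenSelfdual.
Variables (R : realType) (m n r mu : nat) (L : set 'M[R]_(m, n)).
Hypothesis hL : even_selfdual r mu L.

Lemma esd_integral : integral L.
Proof. exact: even_integral (free_of_rank_subgroup (esd_free hL)) (esd_even hL). Qed.

Lemma esd_lattice : lattice_of_rank r L.
Proof.
split; first exact: free_of_rank_Zspan (esd_free hL).
move=> x y Lx Ly; have /intrP[z ->] := esd_integral Lx Ly.
by exists z%:~R; rewrite ratr_int.
Qed.

Lemma esd_even_unimodular : even_unimodular_of_rank r L.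
Proof.
split; [exact: esd_lattice | exact: esd_integral | exact: esd_even hL |].
apply/seteqP; split=> x; first by case=> _; exact: (esd_dual hL).
by move=> Lx; split; [exists 1%N | move=> y Ly; exact: esd_integral Lx Ly].
Qed.

(** Preservation of norms makes [g] injective; the section [h] makes it surjective, which transports
    self-duality. *)
Lemma esd_isometry m' n' (g : {linear 'M[R]_(m, n) -> 'M[R]_(m', n')})
    (h : 'M[R]_(m', n') -> 'M[R]_(m, n)) :
    cancel h g -> (forall x y, inner (g x) (g y) = inner x y) ->
  even_selfdual r mu [set g x | x in L].
Proof.
move=> hK gI.
have g_eq0 x : (g x == 0) = (x == 0) by rewrite -!inner_eq0 gI.
have injg : injective g.
  by move=> x y gxy; apply/eqP; rewrite -subr_eq0 -g_eq0 linearB /= gxy subrr.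
split.
- exact: free_of_rank_image (esd_free hL).
- by move=> _ [x Lx <-]; rewrite gI; exact: (esd_even hL).
- move=> x xL; exists (h x) => //; apply: (esd_dual hL) => y Ly.
  by rewrite -gI hK; apply: xL; exists y.
case: (esd_min hL) => -[x [Lx x0 xmu]] minL; split.
  by exists (g x); rewrite g_eq0 gI; split=> //; exists x.
by move=> _ [y Ly <-]; rewrite g_eq0 gI; exact: minL.
Qed.

End EvenSelfdual.

(** * The lattice L(M,N,k) for a polarization M, N of Y *)

Section PolarizedLattice.
Variables (R : realType) (n mu k : nat) (Y M N : set 'rV[R]_n).
Hypothesis hM : even_selfdual n mu M.
Hypothesis hN : even_selfdual n mu N.
Hypothesis Yfree : free_of_rank n Y.
(** For Y = U / sqrt 2 this is self-duality of U rescaled: the dual of 2 Y = sqrt 2 U is Y. *)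
Hypothesis Ydual :
  forall x, (forall u, Y u -> inner x (2 *: u) \is a Num.int) -> Y x.
Hypothesis Ymin : has_min_norm Y (mu%:R / 2).
Hypothesis sumMN : sumset M N = Y.
Hypothesis capMN : M `&` N = scale 2 Y.
Hypothesis k_gt0 : (0 < k)%N.

Let sgM : is_subgroup M := free_of_rank_subgroup (esd_free hM).
Let sgN : is_subgroup N := free_of_rank_subgroup (esd_free hN).
Let sgY : is_subgroup Y := free_of_rank_subgroup Yfree.

Let sgMN : is_subgroup (M `&` N).
Proof.
split; first by split; [exact: sgM.1 | exact: sgN.1].
by move=> x y [Mx Nx] [My Ny]; split; [exact: sgM.2 | exact: sgN.2].
Qed.

Let MY x : M x -> Y x.
Proof.
move=> Mx; rewrite -sumMN; exists x => //; exists 0; first exact: sgN.1.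
by rewrite addr0.
Qed.

Let NY x : N x -> Y x.
Proof.
move=> Nx; rewrite -sumMN; exists 0; first exact: sgM.1.
by exists x; rewrite ?add0r.
Qed.

Local Notation L := (polarized_lattice M N k).

(** The common row [y] of the diagonal part determines the decomposition of X. *)
Lemma polarized_latticeP (X : 'M[R]_(k, n)) :
  L X <-> exists2 y, N y & (forall i, M (row i X - y)) /\
                           (M `&` N) (\sum_i (row i X - y)).
Proof.
split=> [[A [MA sumA] [B [y Ny By] <-]] | [y Ny [MX sumX]]].
  have AE i : row i (A + B) - y = row i A by rewrite linearD /= By addrK.
  exists y => //; split=> [i|]; first by rewrite AE.
  by under eq_bigr do rewrite AE.
pose B : 'M[R]_(k, n) := \matrix_(i < k) y.
have XE i : row i (X - B) = row i X - y by rewrite linearB /= rowK.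
exists (X - B); last by exists B; [exists y => // i; rewrite rowK | rewrite subrK].
by split=> [i|]; rewrite ?XE //; under eq_bigr do rewrite XE.
Qed.

Lemma polarized_lattice_subgroup : is_subgroup L.
Proof.
split.
  apply/polarized_latticeP; exists 0; first exact: sgN.1.
  split=> [i|]; first by rewrite row0 subr0; exact: sgM.1.
  by rewrite big1 => [|i _]; [exact: sgMN.1 | rewrite row0 subr0].
move=> A B /polarized_latticeP[a Na [MA sumA]] /polarized_latticeP[b Nb [MB sumB]].
have E i : row i (A - B) - (a - b) = (row i A - a) - (row i B - b).
  by rewrite linearB /= !opprD !opprK addrACA.
apply/polarized_latticeP; exists (a - b); first exact: sgN.2.
split=> [i|]; first by rewrite E; exact: sgM.2.
by under eq_bigr do rewrite E; rewrite sumrB; exact: sgMN.2.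
Qed.

Lemma polarized_lattice_rows_cap (X : 'M[R]_(k, n)) :
  (forall i, M (row i X)) -> (M `&` N) (\sum_i row i X) -> L X.
Proof.
move=> MX sumX; apply/polarized_latticeP; exists 0; first exact: sgN.1.
by split=> [i|]; rewrite ?subr0 //; under eq_bigr do rewrite subr0.
Qed.

(** L lies between 2 Y^k and Y^k, because 2 Y is the intersection of M and N. *)
Lemma polarized_lattice_free : free_of_rank (k * n) L.
Proof.
apply: (@free_of_rank_between _ _ _ _ _ _ 2 _ polarized_lattice_subgroup
  (free_of_rank_rows k Yfree)) => // [X|X YX].
  move=> /polarized_latticeP[y Ny [MX _]] i.
  by rewrite -(subrK y (row i X)); apply: is_subgroupD => //; [exact: MY | exact: NY].
have MNX i : (M `&` N) (row i (X *~ 2)).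
  by rewrite capMN; exists (row i X) => //; rewrite raddfMz /= -scaler_int.
apply: polarized_lattice_rows_cap => [i|]; first by case: (MNX i).
exact: is_subgroup_sum.
Qed.

(** With a_i = x_i - y, the norm is the sum of the (a_i, a_i), plus 2 (sum a_i, y), plus k (y, y).
    The outer terms are even as M and N are; the middle one is even since sum a_i and y both lie in
    the integral lattice N. *)
Lemma polarized_lattice_even : even L.
Proof.
move=> X /polarized_latticeP[y Ny [MX [_ sumX]]]; apply/even_numberP.
have -> : inner X X = \sum_i inner (row i X - y) (row i X - y)
    + 2 * inner (\sum_i (row i X - y)) y + inner y y *+ k.
  rewrite inner_suml inner_row mulr_sumr -[in X in _ = _ + X](card_ord k) -sumr_const.
  rewrite -!big_split; apply: eq_bigr => i _ /=.
  rewrite -{1 2}(subrK y (row i X)); move: (row i X - y) => a.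
  by rewrite innerDl !innerDr (innerC y a); ring.
rewrite mulrDl; apply: rpredD; last first.
  by rewrite mulrnAl rpredMn //; apply/even_numberP; exact: (esd_even hN).
rewrite mulrDl; apply: rpredD.
  rewrite mulr_suml rpred_sum // => i _; apply/even_numberP.
  exact: (esd_even hM).
by rewrite mulrAC mulfV ?pnatr_eq0 // mul1r; exact: (esd_integral hN).
Qed.

Definition single_row (i : 'I_k) (x : 'rV[R]_n) : 'M[R]_(k, n) :=
  \matrix_j (if j == i then x else 0).

Lemma inner_single_row (X : 'M[R]_(k, n)) i x : inner X (single_row i x) = inner (row i X) x.
Proof.
rewrite inner_row (bigD1 i) //= rowK eqxx big1 ?addr0 // => j ji.
by rewrite rowK (negPf ji) inner0r.
Qed.

Lemma polarized_lattice_single i u : Y u -> L (single_row i (2 *: u)).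
Proof.
move=> Yu; have MNu : (M `&` N) (2 *: u) by rewrite capMN; exists u.
have MNX j : (M `&` N) (row j (single_row i (2 *: u))).
  by rewrite rowK; case: ifP => _ //; exact: sgMN.1.
apply: polarized_lattice_rows_cap => [j|]; first by case: (MNX j).
exact: is_subgroup_sum.
Qed.

(** X is tested against three families in L: a vector of M in one row and its opposite in another, a
    vector of 2 Y in a single row, and constant rows from N. They control the differences of rows,
    one row, and the sum of the rows. *)
Lemma polarized_lattice_dual (X : 'M[R]_(k, n)) :
  (forall Z, L Z -> inner X Z \is a Num.int) -> L X.
Proof.
move=> XL; pose i0 := Ordinal k_gt0.
have Mdiff i j : M (row i X - row j X).
  apply: (esd_dual hM) => y My.
  have : inner X (single_row i y - single_row j y) \is a Num.int.
    apply/XL/polarized_lattice_rows_cap => [l|].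
      rewrite linearB /= !rowK; apply: sgM.2.
        by case: ifP => _ //; exact: sgM.1.
      by case: ifP => _ //; exact: sgM.1.
    suff -> : \sum_l row l (single_row i y - single_row j y) = 0 by exact: sgMN.1.
    under eq_bigr do rewrite linearB /= !rowK.
    by rewrite sumrB -!big_mkcond /= !big_pred1_eq subrr.
  by rewrite innerDr innerNr !inner_single_row innerDl innerNl.
have : Y (row i0 X).
  apply: Ydual => u Yu; rewrite -inner_single_row.
  exact/XL/polarized_lattice_single.
(* The N-component [y] of row [i0] serves for every row, as the rows agree modulo M. *)
rewrite -sumMN => -[a Ma [y Ny ayE]].
have MX i : M (row i X - y).
  rewrite -(subrK (row i0 X) (row i X)) -addrA -[in X in _ + X]ayE addrK.
  by apply: is_subgroupD => //; exact: Mdiff.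
apply/polarized_latticeP; exists y => //; split=> //; split.
  exact: is_subgroup_sum.
apply: (esd_dual hN) => z Nz.
pose C (x : 'rV[R]_n) : 'M[R]_(k, n) := \matrix_(i < k) x.
have CC x : N x -> L (C x).
  move=> Nx; apply/polarized_latticeP; exists x => //.
  split=> [i|]; first by rewrite rowK subrr; exact: sgM.1.
  by rewrite big1 => [|i _]; [exact: sgMN.1 | rewrite rowK subrr].
have LC := polarized_lattice_subgroup.
(* The correction by the constant matrix [C y] is harmless: [C y] and [C z] are in L, which is
   integral. *)
have -> : inner (\sum_i (row i X - y)) z = inner X (C z) - inner (C y) (C z).
  rewrite inner_suml !inner_row -sumrB; apply: eq_bigr => i _.
  by rewrite !rowK innerDl innerNl.
apply: rpredB; first exact/XL/CC.
exact: (even_integral LC polarized_lattice_even (CC _ Ny) (CC _ Nz)).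
Qed.

Lemma le_inner_row (X : 'M[R]_(k, n)) (i : 'I_k) : inner (row i X) (row i X) <= inner X X.
Proof.
rewrite [leRHS]inner_row (bigD1 i) //= lerDl.
by apply: sumr_ge0 => j _; exact: inner_ge0.
Qed.

(* If y is not in M, no row of X vanishes, and each contributes at least mu/2;
   otherwise all rows are in M, with sum in M `&` N = 2 Y. *)
Lemma polarized_lattice_le_norm (X : 'M[R]_(k, n)) : (4 * mu < k * mu + 4)%N ->
  L X -> X != 0 -> (2 * mu)%:R <= inner X X.
Proof.
move=> kmu LX X0; have [[y Ny [MX sumX]] Ym] := ((polarized_latticeP X).1 LX, Ymin.2).
have [/existsP[i /eqP Xi0]|] := boolP [exists i, row i X == 0]; last first.
  rewrite negb_exists => /forallP X_neq0.
  have [z zE] := polarized_lattice_even LX.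
  have : mu%:R / 2 *+ k <= inner X X.
    rewrite inner_row -[in leLHS](card_ord k) -sumr_const.
    apply: ler_sum => i _; apply: Ym => //.
    by rewrite -(subrK y (row i X)); apply: is_subgroupD => //; [exact: MY | exact: NY].
  rewrite zE => zk.
  (* The norm is 2 z with 4 z >= k mu > 4 mu - 4, so z > mu - 1; integrality of z improves this to z
     >= mu. *)
  have : (k * mu)%:Z <= 4 * z.
    rewrite -(ler_int R) -[X in X <= _]/((k * mu)%:R) natrM.
    by move: zk; rewrite -mulr_natl !intrM => zk; lra.
  rewrite -[(2 * mu)%:R]/((2 * mu)%:Z%:~R) ler_int; lia.
(* A zero row puts - y in M. *)
have My : M y.
  by have := is_subgroupN sgM (MX i); rewrite Xi0 sub0r opprK.
have MXi j : M (row j X).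
  by rewrite -(subrK y (row j X)); apply: is_subgroupD.
have [j Xj0] : exists j, row j X != 0.
  apply/existsP; rewrite -negb_forall; apply: contra X0 => /forallP X0.
  by apply/eqP/row_matrixP => j; rewrite row0; exact/eqP.
have Mm := (esd_min hM).2.
(* Two nonzero rows, both in M, contribute at least mu each. *)
have [/existsP[l /andP[lj Xl0]]|] := boolP [exists l, (l != j) && (row l X != 0)].
  rewrite inner_row (bigD1 j) //= (bigD1 l) //= mulnC muln2 -addnn natrD.
  rewrite lerD ?Mm // -[leLHS]addr0 lerD ?Mm //.
  by apply: sumr_ge0 => ? _; exact: inner_ge0.
rewrite negb_exists => /forallP Xl0.
have XE l : l != j -> row l X = 0.
  by move=> lj; have := Xl0 l; rewrite lj /= negbK => /eqP.
(* The only nonzero row is the sum of all rows, hence lies in 2 Y, whose minimum is 4 (mu / 2). *)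
have : (M `&` N) (row j X).
  have -> : row j X = \sum_l (row l X - y) + y *+ k.
    rewrite -[in X in _ = _ + X](card_ord k) -sumr_const -big_split /=.
    rewrite (bigD1 j) //= subrK big1 ?addr0 // => l lj.
    by rewrite subrK XE.
  by apply: is_subgroupD => //; exact: is_subgroup_muln.
rewrite capMN => -[u Yu uE].
apply: le_trans (le_inner_row X j); rewrite -uE innerZl innerZr natrM.
have : u != 0 by apply: contraNneq Xj0 => u0; rewrite -uE u0 scaler0.
move=> /(Ym _ Yu); lra.
Qed.

Lemma polarized_lattice_esd : (4 * mu < k * mu + 4)%N ->
  even_selfdual (k * n) (2 * mu) L.
Proof.
move=> kmu; split.
- exact: polarized_lattice_free.
- exact: polarized_lattice_even.
- exact: polarized_lattice_dual.
split; last by move=> X; exact: polarized_lattice_le_norm.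
(* The bound is attained by twice a minimal vector of Y placed in one row. *)
have [u [Yu u0 umu]] := Ymin.1; pose i0 := Ordinal k_gt0.
have uE : inner (single_row i0 (2 *: u)) (single_row i0 (2 *: u)) = (2 * mu)%:R.
  by rewrite inner_single_row rowK eqxx innerZl innerZr umu natrM; field.
exists (single_row i0 (2 *: u)); split => //.
  exact: polarized_lattice_single.
by rewrite -inner_eq0 inner_single_row rowK eqxx inner_eq0 scaler_eq0 negb_or u0 pnatr_eq0.
Qed.

End PolarizedLattice.

(** * Coordinatewise action of a matrix on k-tuples *)

Section LinMulmxr.
Variables (R : comNzRingType) (k n : nat).
Implicit Types A B : 'M[R]_n.
Local Notation lmr := (@lin_mulmxr R k n n).

(** Block diagonal form: k copies of [A], one for each row. *)
Lemma lin_mulmxrE A i j i' j' :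
  lmr A (mxvec_index i j) (mxvec_index i' j') = (i == i')%:R * A j j'.
Proof.
rewrite !mxE /= vec_mx_delta mxvecE mxE (bigD1 j) //= big1 => [|l lj].
  by rewrite addr0 mxE eqxx andbT eq_sym.
by rewrite mxE (negPf lj) andbF mul0r.
Qed.

Lemma tr_lin_mulmxr A : (lmr A)^T = lmr A^T.
Proof.
apply/matrixP => p q; case/mxvec_indexP: p => i j; case/mxvec_indexP: q => i' j'.
by rewrite mxE !lin_mulmxrE mxE eq_sym.
Qed.

Lemma lin_mulmxrM A B : lmr A *m lmr B = lmr (A *m B).
Proof.
apply/row_matrixP => i; rewrite !rowE -[delta_mx 0 i]vec_mxK mulmxA.
by rewrite !mul_vec_lin /= mulmxA.
Qed.

Lemma lin_mulmxr_scalar a : lmr a%:M = a%:M.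
Proof.
apply/row_matrixP => i; rewrite !rowE -[delta_mx 0 i]vec_mxK.
by rewrite mul_vec_lin /= !mul_mx_scalar linearZ.
Qed.

End LinMulmxr.

(** * Matrices playing the role of (1 + sqrt -7) / 2 *)

(* A stands for multiplication by (1 + sqrt -7) / 2, and A^T for that by its
   conjugate. *)
Definition half_seven (R : realType) n (A : 'M[R]_n) : Prop :=
  A^T = 1%:M - A /\ A *m A^T = 2%:M.

Section HalfSeven.
Variables (R : realType) (n : nat) (A : 'M[R]_n).
Hypothesis hA : half_seven A.

Lemma half_seven_addT : A + A^T = 1%:M.
Proof. by rewrite hA.1 addrC subrK. Qed.

Lemma half_seven_mulTx : A^T *m A = 2%:M.
Proof. by rewrite -hA.2 hA.1 mulmxBl mulmxBr mul1mx mulmx1. Qed.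

Lemma half_seven_tr : half_seven A^T.
Proof.
split; first by rewrite trmxK hA.1 opprB addrC subrK.
by rewrite trmxK half_seven_mulTx.
Qed.

Lemma half_seven_lin k : half_seven (@lin_mulmxr R k n n A).
Proof.
split; rewrite tr_lin_mulmxr.
  by rewrite hA.1 linearB /= lin_mulmxr_scalar.
by rewrite lin_mulmxrM hA.2 lin_mulmxr_scalar.
Qed.

End HalfSeven.

(** * The polarization of U / sqrt 2 given by such a matrix *)

Section HalfLattice.
Variables (R : realType) (n mu : nat) (U : set 'rV[R]_n).
Hypothesis hU : even_selfdual n mu U.
Local Notation s := (Num.sqrt 2)^-1.

Lemma sqr_isqrt2 : s * s = 2^-1 :> R.
Proof. by rewrite -invfM -expr2 sqr_sqrtr. Qed.

Lemma isqrt2_neq0 : s != 0 :> R.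
Proof. by rewrite invr_eq0 sqrtr_eq0 -ltNge. Qed.

Definition half_lattice (A : 'M[R]_n) : set 'rV[R]_n :=
  [set x *m (s *: A) | x in U].

(** Since A A^T = 2, the matrix A / sqrt 2 is orthogonal, with inverse A^T / sqrt 2. *)
Lemma half_lattice_esd A : half_seven A -> even_selfdual n mu (half_lattice A).
Proof.
move=> hA; have hAT := half_seven_mulTx hA.
apply: (esd_isometry hU (g := mulmxr (s *: A)) (h := fun x => x *m (s *: A^T))).
  move=> x /=; rewrite -mulmxA -scalemxAl -!scalemxAr scalerA sqr_isqrt2 hAT.
  by rewrite mul_mx_scalar scalerA mulVf ?pnatr_eq0 // scale1r.
move=> x y; rewrite /= inner_mulmxl -mulmxA linearZ /=.
rewrite -scalemxAl -!scalemxAr scalerA sqr_isqrt2 hA.2.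
by rewrite mul_mx_scalar scalerA mulVf ?pnatr_eq0 // scale1r.
Qed.

Lemma scale_free a : a != 0 -> free_of_rank n (scale a U).
Proof.
move=> a0; apply: (free_of_rank_image (g := ( *:%R a))) (esd_free hU).
exact: scalerI.
Qed.

Lemma scale_isqrt2_min : has_min_norm (scale s U) (mu%:R / 2).
Proof.
have nE (x : 'rV[R]_n) : inner (s *: x) (s *: x) = inner x x / 2.
  by rewrite innerZl innerZr mulrA sqr_isqrt2 mulrC.
have s0 (x : 'rV[R]_n) : (s *: x == 0) = (x == 0).
  by rewrite scaler_eq0 (negPf isqrt2_neq0).
have [[x [Ux x0 xmu]] minU] := esd_min hU; split.
  by exists (s *: x); rewrite nE s0 xmu; split=> //; exists x.
move=> _ [y Uy <-]; rewrite s0 nE => y0.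
by rewrite ler_pM2r ?invr_gt0 //; apply: minU.
Qed.

Lemma scale_isqrt2_dual x :
  (forall u, scale s U u -> inner x (2 *: u) \is a Num.int) -> scale s U x.
Proof.
move=> xint; have ss : s * s * 2 = 1 :> R by rewrite sqr_isqrt2 mulVf ?pnatr_eq0.
(* [s * 2] is sqrt 2, and sqrt 2 x pairs integrally with U. *)
exists ((s * 2) *: x); last by rewrite scalerA mulrA ss scale1r.
apply: (esd_dual hU) => y Uy.
have := xint (s *: y); rewrite innerZl !innerZr mulrA (mulrC 2); apply.
by exists y.
Qed.

Variable A : 'M[R]_n.
Hypothesis hA : half_seven A.
Hypothesis stabA : forall x, U x -> U (x *m A).

Let sgU : is_subgroup U := free_of_rank_subgroup (esd_free hU).

Lemma half_seven_stableT x : U x -> U (x *m A^T).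
Proof. by move=> Ux; rewrite hA.1 mulmxBr mulmx1; apply: sgU.2 => //; exact: stabA. Qed.

Lemma half_lattice_add : sumset (half_lattice A) (half_lattice A^T) = scale s U.
Proof.
apply/seteqP; split=> [_ [_ [x Ux <-] [_ [y Uy <-] <-]] | _ [x Ux <-]].
  exists (x *m A + y *m A^T); last by rewrite scalerDr !scalemxAr.
  by apply: is_subgroupD => //; [exact: stabA | exact: half_seven_stableT].
exists (x *m (s *: A)); first by exists x.
exists (x *m (s *: A^T)); first by exists x.
by rewrite -mulmxDr -scalerDr half_seven_addT // -scalemxAr mulmx1.
Qed.

(** If z = s x A = s y A^T, then z = z A + z A^T = 2 s (y + x), using A^T A = A A^T = 2. Conversely
    2 s x is both s (x A^T) A and s (x A) A^T. *)
Lemma half_lattice_cap :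
  half_lattice A `&` half_lattice A^T = scale 2 (scale s U).
Proof.
apply/seteqP; split=> [z [[x Ux xz] [y Uy yz]] | _ [_ [x Ux <-] <-]]; last first.
  split.
    exists (x *m A^T); first exact: half_seven_stableT.
    by rewrite -scalemxAr -mulmxA half_seven_mulTx // mul_mx_scalar !scalerA mulrC.
  exists (x *m A); first exact: stabA.
  by rewrite -scalemxAr -mulmxA hA.2 mul_mx_scalar !scalerA mulrC.
exists (s *: (x + y)); first by exists (x + y) => //; exact: is_subgroupD.
rewrite -[z]mulmx1 -(half_seven_addT hA) mulmxDr -{1}yz -xz.
rewrite -!mulmxA -!scalemxAl half_seven_mulTx // hA.2 -!scalemxAr !mul_mx_scalar.
by rewrite !scalerA mulrC -scalerDr addrC.
Qed.

Lemma half_lattice_polarization :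
  polarization (scale s U) (half_lattice A) (half_lattice A^T).
Proof.
have hM := half_lattice_esd hA; have hN := half_lattice_esd (half_seven_tr hA).
split; [| |exact: half_lattice_add | exact: half_lattice_cap].
  split; [by exists n; exact: esd_lattice hM | | exact: esd_integral hM].
  by move=> _ [x Ux <-]; exists (x *m A); [exact: stabA | rewrite scalemxAr].
split; [by exists n; exact: esd_lattice hN | | exact: esd_integral hN].
move=> _ [x Ux <-]; exists (x *m A^T); last by rewrite scalemxAr.
exact: half_seven_stableT.
Qed.

Lemma polarized_half_lattice_esd k : (0 < k)%N -> (4 * mu < k * mu + 4)%N ->
  even_selfdual (k * n) (2 * mu)
    (polarized_lattice (half_lattice A) (half_lattice A^T) k).
Proof.
move=> k0 kmu.
apply: (polarized_lattice_esd (half_lattice_esd hA)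
  (half_lattice_esd (half_seven_tr hA)) (scale_free isqrt2_neq0)) => //.
- exact: scale_isqrt2_dual.
- exact: scale_isqrt2_min.
- exact: half_lattice_add.
- exact: half_lattice_cap.
Qed.

(** [A] commutes with [A^T], so it preserves both half lattices; the diagonal component [y] becomes
    [y *m A]. *)
Lemma polarized_half_lattice_stable k X :
  polarized_lattice (half_lattice A) (half_lattice A^T) k X ->
  polarized_lattice (half_lattice A) (half_lattice A^T) k (X *m A).
Proof.
have stM B x : half_seven B -> (B = A \/ B = A^T) ->
    half_lattice B x -> half_lattice B (x *m A).
  move=> hB BE [y Uy <-]; exists (y *m A); first exact: stabA.
  rewrite -!mulmxA -scalemxAl -scalemxAr; congr (_ *m (_ *: _)).
  by case: BE => ->; rewrite // half_seven_mulTx // hA.2.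
have hAT := half_seven_tr hA.
have MA x : half_lattice A x -> half_lattice A (x *m A) by apply: stM; [|left].
have NA x : half_lattice A^T x -> half_lattice A^T (x *m A) by apply: stM; [|right].
move=> /(polarized_latticeP _ _)[y Ny [MX [sM sN]]].
apply/polarized_latticeP; exists (y *m A); first exact: NA.
have E i : row i (X *m A) - y *m A = (row i X - y) *m A by rewrite row_mul mulmxBl.
split=> [i|]; first by rewrite E; exact: MA.
under eq_bigr do rewrite E.
by rewrite -mulmx_suml; split; [exact: MA | exact: NA].
Qed.

End HalfLattice.

(** * Iterating the construction *)

Definition half_seven_lattice (R : realType) n mu (U : set 'rV[R]_n) : Prop :=
  even_selfdual n mu U /\
  exists2 A : 'M[R]_n, half_seven A & forall x, U x -> U (x *m A).

(** Flattening by [mxvec] gives a lattice of row vectors again, so that the step can be repeated. *)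
Lemma half_seven_lattice_step (R : realType) n mu k (U : set 'rV[R]_n) :
    (0 < k)%N -> (4 * mu < k * mu + 4)%N -> half_seven_lattice mu U ->
  exists V : set 'rV[R]_(k * n), half_seven_lattice (2 * mu) V.
Proof.
move=> k0 kmu [hU [A hA stabA]].
exists [set mxvec X | X in polarized_lattice (half_lattice U A) (half_lattice U A^T) k].
split.
  apply: (esd_isometry (polarized_half_lattice_esd hU hA stabA k0 kmu) (h := vec_mx)).
    exact: vec_mxK.
  by move=> X Y; rewrite inner_mxvec.
exists (lin_mulmxr A); first exact: half_seven_lin.
move=> _ [X LX <-]; rewrite mul_vec_lin /=; exists (X *m A) => //.
exact: polarized_half_lattice_stable.
Qed.

(** The last round, which keeps the k-tuples as matrices and exhibits the polarization. *)
Lemma half_seven_lattice_polarized (R : realType) n mu k (U : set 'rV[R]_n) :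
    (1 < k)%N -> (4 * mu < k * mu + 4)%N -> half_seven_lattice mu U ->
  exists (M N : set 'rV[R]_n),
    [/\ even_unimodular U, polarization (scale (Num.sqrt 2)^-1 U) M N,
        even_unimodular_of_rank (k * n) (polarized_lattice M N k) &
        has_min_norm (polarized_lattice M N k) (2 * mu)%:R].
Proof.
move=> k1 kmu [hU [A hA stabA]]; exists (half_lattice U A), (half_lattice U A^T).
have hL := polarized_half_lattice_esd hU hA stabA (ltnW k1) kmu.
have pol := half_lattice_polarization hU hA stabA.
split=> //; [| exact: esd_even_unimodular hL | exact: esd_min hL].
by exists n; exact: esd_even_unimodular hU.
Qed.

(** * Integer matrices as nested sequences, for checks by computation *)

Section SeqMatrices.
Variables (n : nat) (R : realType).

Definition mxseq (s : seq (seq int)) : 'M[int]_n :=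
  \matrix_(i, j) nth 0 (nth [::] s i) j.

Definition seq_forall2 (P : nat -> nat -> bool) : bool :=
  all (fun i => all (P i) (iota 0 n)) (iota 0 n).

Lemma seq_forall2P P : seq_forall2 P -> forall i j : 'I_n, P i j.
Proof.
move=> /allP Pij i j; have ord_iota (k : 'I_n) : (k : nat) \in iota 0 n.
  by rewrite mem_iota ltn_ord.
exact: (allP (Pij i (ord_iota i)) j (ord_iota j)).
Qed.

Definition seq_dot (s t : seq (seq int)) (i j : nat) : int :=
  foldr (fun k a => nth 0 (nth [::] s i) k * nth 0 (nth [::] t k) j + a) 0
    (iota 0 n).

Lemma mxseqM s t u :
  seq_forall2 (fun i j => seq_dot s t i j == nth 0 (nth [::] u i) j) ->
  mxseq s *m mxseq t = mxseq u.
Proof.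
move=> /seq_forall2P stu; apply/matrixP => i j; rewrite !mxE.
rewrite -(eqP (stu i j)) /seq_dot.
under eq_bigr do rewrite !mxE.
rewrite -(big_mkord xpredT
  (fun k => nth 0 (nth [::] s i) k * nth 0 (nth [::] t k) j)).
(* Unlocked, the big sum is literally the [foldr] of [seq_dot]. *)
by rewrite unlock /reducebig /index_iota subn0.
Qed.

Definition seq_tr (s : seq (seq int)) : seq (seq int) :=
  mkseq (fun i => mkseq (fun j => nth 0 (nth [::] s j) i) n) n.

Lemma tr_mxseq s : (mxseq s)^T = mxseq (seq_tr s).
Proof. by apply/matrixP => i j; rewrite !mxE !nth_mkseq. Qed.

Definition seq_scalar (a : int) : seq (seq int) :=
  mkseq (fun i => mkseq (fun j => if i == j then a else 0) n) n.

Lemma mxseq_scalar a : mxseq (seq_scalar a) = a%:M.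
Proof.
apply/matrixP => i j; rewrite !mxE !nth_mkseq // -val_eqE /=.
by case: eqP.
Qed.

End SeqMatrices.

(** * The E8 lattice and its action of (1 + sqrt -7) / 2 *)

Section E8.
Variable R : realType.
Local Notation s := (Num.sqrt 2)^-1.
Local Notation real M := (map_mx (intr : int -> R) M).

(* The quadratic residues 1, 2, 4 modulo 7 give the signs. *)
Definition paley_skew : seq (seq int) :=
  [:: [:: 0; 1; 1; 1; 1; 1; 1; 1]; [:: -1; 0; 1; 1; -1; 1; -1; -1];
      [:: -1; -1; 0; 1; 1; -1; 1; -1]; [:: -1; -1; -1; 0; 1; 1; -1; 1];
      [:: -1; 1; -1; -1; 0; 1; 1; -1]; [:: -1; -1; 1; -1; -1; 0; 1; 1];
      [:: -1; 1; -1; 1; -1; -1; 0; 1]; [:: -1; 1; 1; -1; 1; -1; -1; 0]].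

(* The rows span the integer vectors that reduce modulo 2 to the extended
   Hamming code. *)
Definition hamming_basis : seq (seq int) :=
  [:: [:: 1; 0; 0; 0; 1; 1; 0; 1]; [:: 0; 1; 0; 0; 1; 0; 1; 1];
      [:: 0; 0; 1; 0; 1; 1; 1; 0]; [:: 0; 0; 0; 1; 0; 1; 1; 1];
      [:: 0; 0; 0; 0; 2; 0; 0; 0]; [:: 0; 0; 0; 0; 0; 2; 0; 0];
      [:: 0; 0; 0; 0; 0; 0; 2; 0]; [:: 0; 0; 0; 0; 0; 0; 0; 2]].

(* Coordinates of the rows of hamming_basis * (1 + paley_skew) / 2. *)
Definition hamming_action : seq (seq int) :=
  [:: [:: -1; 1; 1; -1; 0; 1; 0; 1]; [:: -2; 2; 0; 0; 0; 1; -1; 0];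
      [:: -2; 0; 0; 0; 1; 1; 1; 1]; [:: -2; 0; 0; 0; 1; 1; 0; 2];
      [:: -1; 1; -1; -1; 1; 2; 1; 0]; [:: -1; -1; 1; -1; 0; 1; 1; 2];
      [:: -1; 1; -1; 1; 0; 0; 0; 0]; [:: -1; 1; 1; -1; 0; 0; -1; 1]].

(* The upper triangle of E8_gram with its diagonal halved. *)
Definition E8_half : seq (seq int) :=
  [:: [:: 1; 1; 1; 1; 1; 1; 0; 1]; [:: 0; 1; 1; 1; 1; 0; 1; 1];
      [:: 0; 0; 1; 1; 1; 1; 1; 0]; [:: 0; 0; 0; 1; 0; 1; 1; 1];
      [:: 0; 0; 0; 0; 1; 0; 0; 0]; [:: 0; 0; 0; 0; 0; 1; 0; 0];
      [:: 0; 0; 0; 0; 0; 0; 1; 0]; [:: 0; 0; 0; 0; 0; 0; 0; 1]].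

Definition E8_inv : seq (seq int) :=
  [:: [:: 2; 0; 0; 0; -1; -1; 0; -1]; [:: 0; 2; 0; 0; -1; 0; -1; -1];
      [:: 0; 0; 2; 0; -1; -1; -1; 0]; [:: 0; 0; 0; 2; 0; -1; -1; -1];
      [:: -1; -1; -1; 0; 2; 1; 1; 1]; [:: -1; 0; -1; -1; 1; 2; 1; 1];
      [:: 0; -1; -1; -1; 1; 1; 2; 1]; [:: -1; -1; 0; -1; 1; 1; 1; 2]].

Definition E8_gram : seq (seq int) :=
  [:: [:: 2; 1; 1; 1; 1; 1; 0; 1]; [:: 1; 2; 1; 1; 1; 0; 1; 1];
      [:: 1; 1; 2; 1; 1; 1; 1; 0]; [:: 1; 1; 1; 2; 0; 1; 1; 1];
      [:: 1; 1; 1; 0; 2; 0; 0; 0]; [:: 1; 0; 1; 1; 0; 2; 0; 0];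
      [:: 0; 1; 1; 1; 0; 0; 2; 0]; [:: 1; 1; 0; 1; 0; 0; 0; 2]].

Lemma paley_skew_tr : (mxseq 8 paley_skew)^T = - mxseq 8 paley_skew.
Proof.
apply/matrixP => i j; rewrite !mxE; apply/eqP; move: i j.
by apply: (@seq_forall2P 8 (fun i j => nth 0 (nth [::] paley_skew j) i
  == - nth 0 (nth [::] paley_skew i) j)).
Qed.

Lemma paley_skew_sqr : mxseq 8 paley_skew *m mxseq 8 paley_skew = (- 7)%:M.
Proof. by rewrite -mxseq_scalar; apply: mxseqM. Qed.

Lemma hamming_gram :
  mxseq 8 hamming_basis *m (mxseq 8 hamming_basis)^T = 2 *: mxseq 8 E8_gram.
Proof.
rewrite -mul_mx_scalar -mxseq_scalar tr_mxseq.
(* Both products are compared with one computed table [u]. *)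
pose u := mkseq (fun i => mkseq (fun j =>
   seq_dot 8 E8_gram (seq_scalar 8 2) i j) 8) 8.
by rewrite (@mxseqM 8 _ _ u) // (@mxseqM 8 _ _ u).
Qed.

(** Writing the Gram matrix as H + H^T gives c the norm 2 c H c^T, whence evenness. *)
Lemma E8_gram_even : mxseq 8 E8_gram = mxseq 8 E8_half + (mxseq 8 E8_half)^T.
Proof.
apply/matrixP => i j; rewrite !mxE; apply/eqP; move: i j.
by apply: (@seq_forall2P 8 (fun i j => nth 0 (nth [::] E8_gram i) j
  == nth 0 (nth [::] E8_half i) j + nth 0 (nth [::] E8_half j) i)).
Qed.

Lemma E8_gram_inv : mxseq 8 E8_inv *m mxseq 8 E8_gram = 1%:M.
Proof. by rewrite -mxseq_scalar; apply: mxseqM. Qed.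

Lemma hamming_stable :
  mxseq 8 hamming_basis *m (1%:M + mxseq 8 paley_skew)
    = 2 *: (mxseq 8 hamming_action *m mxseq 8 hamming_basis).
Proof.
pose u := mkseq (fun i => mkseq (fun j =>
   seq_dot 8 hamming_basis paley_skew i j) 8) 8.
pose v := mkseq (fun i => mkseq (fun j =>
   seq_dot 8 hamming_action hamming_basis i j) 8) 8.
rewrite mulmxDr mulmx1 (@mxseqM 8 _ _ u) // (@mxseqM 8 _ _ v) //.
apply/matrixP => i j; rewrite !mxE; apply/eqP; move: i j.
by apply: (@seq_forall2P 8 (fun i j => nth 0 (nth [::] hamming_basis i) j
  + nth 0 (nth [::] u i) j == 2 * nth 0 (nth [::] v i) j)).
Qed.

(** Construction A applied to the extended Hamming code. *)
Definition E8_basis : 'M[R]_8 := s *: real (mxseq 8 hamming_basis).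

Definition E8 : set 'rV[R]_8 := [set real c *m E8_basis | c in setT].

Definition E8_alpha : 'M[R]_8 := 2^-1 *: (1%:M + real (mxseq 8 paley_skew)).

(** [S] is skew with square -7, so transposition is conjugation and A A^T = (1 - S^2) / 4 = 2. *)
Lemma E8_half_seven : half_seven E8_alpha.
Proof.
set S := real (mxseq 8 paley_skew); pose I8 := 1%:M : 'M[R]_8.
have ST : S^T = - S by rewrite map_trmx paley_skew_tr map_mxN.
have SS : S *m S = (- 7)%:M by rewrite -map_mxM paley_skew_sqr map_scalar_mx.
have AT : E8_alpha^T = 2^-1 *: (I8 - S).
  by rewrite /E8_alpha linearZ linearD /= ST tr_scalar_mx.
split.
  rewrite AT /E8_alpha -/S; apply/matrixP => i j; rewrite !mxE; lra.
rewrite AT /E8_alpha -/S -scalemxAl -scalemxAr scalerA.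
rewrite mulmxBr mulmx1 mulmxDl mul1mx SS opprD addrA addrK.
rewrite -raddfB scale_scalar_mx; congr _%:M; lra.
Qed.

Lemma E8_basis_gram :
  E8_basis *m E8_basis^T = real (mxseq 8 E8_gram).
Proof.
rewrite /E8_basis linearZ /= -scalemxAl -scalemxAr scalerA sqr_isqrt2.
rewrite map_trmx -map_mxM hamming_gram map_mxZ scalerA mulVf ?scale1r //.
by rewrite pnatr_eq0.
Qed.

Lemma E8_basis_inv : real (mxseq 8 E8_inv) *m E8_basis *m E8_basis^T = 1%:M.
Proof. by rewrite -mulmxA E8_basis_gram -map_mxM E8_gram_inv map_mx1. Qed.

Lemma E8_basis_unit : E8_basis \in unitmx.
Proof. by have [_] := mulmx1_unit E8_basis_inv; rewrite unitmx_tr. Qed.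

Lemma inner_intr n (c d : 'rV[int]_n) : inner (real c) (real d) \is a Num.int.
Proof.
by apply: rpred_sum => i _; apply: rpred_sum => j _; rewrite !mxE -intrM intr_int.
Qed.

Lemma E8_even : even E8.
Proof.
move=> _ [c _ <-]; apply/even_numberP.
rewrite inner_mulmxl -mulmxA E8_basis_gram E8_gram_even map_mxD mulmxDr innerDr.
rewrite -map_trmx -inner_mulmxl (innerC (_ *m _)) -map_mxM.
set a := inner _ _; have -> : (a + a) / 2 = a by lra.
exact: inner_intr.
Qed.

Lemma E8_dual x : (forall y, E8 y -> inner x y \is a Num.int) -> E8 x.
Proof.
move=> xint; pose z := x *m E8_basis^T.
have zint i : exists k : int, z 0 i = k%:~R.
  apply/intrP; have -> : z 0 i = inner x (real (delta_mx 0 i) *m E8_basis).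
    by rewrite innerC inner_mulmxl map_delta_mx inner_delta.
  by apply: xint; exists (delta_mx 0 i).
have [c cE] := choice zint.
have zE : z = real (\row_i c i) by apply/rowP => i; rewrite [LHS]cE !mxE.
(* The entries of [z] are the pairings of [x] with the basis; the integral inverse of the Gram
   matrix turns them into coordinates. *)
exists ((\row_i c i) *m mxseq 8 E8_inv) => //.
have injT : injective (fun v : 'rV[R]_8 => v *m E8_basis^T).
  by apply: (can_inj (mulmxK _)); rewrite unitmx_tr E8_basis_unit.
by apply: injT; rewrite /= map_mxM -zE -!mulmxA [real _ *m _]mulmxA E8_basis_inv mulmx1.
Qed.

Lemma E8_free : free_of_rank 8 E8.
Proof.
exists (mulmxr E8_basis); split=> //; first exact: linearP.
exact: (can_inj (mulmxK E8_basis_unit)).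
Qed.

(** A positive even norm is at least 2, and the first basis vector has norm 2. *)
Lemma E8_min : has_min_norm E8 2%:R.
Proof.
pose e : 'rV[int]_8 := delta_mx 0 0; pose x := real e *m E8_basis.
have xx : inner x x = 2%:R.
  rewrite inner_mulmxl -mulmxA E8_basis_gram map_delta_mx inner_delta.
  by rewrite -rowE !mxE.
split; first by exists x; split=> //; [exists e | rewrite -inner_eq0 xx pnatr_eq0].
move=> y Ey y0; have := inner_gt0 y0.
have [z ->] := E8_even Ey.
by rewrite (ltr_int _ 0) -[leLHS]/(2%:Z%:~R) ler_int; lia.
Qed.

Lemma E8_half_seven_lattice : half_seven_lattice 2 E8.
Proof.
split; first by split; [exact: E8_free | exact: E8_even | exact: E8_dual | exact: E8_min].
exists E8_alpha; first exact: E8_half_seven.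
move=> _ [c _ <-]; exists (c *m mxseq 8 hamming_action) => //.
rewrite map_mxM -!mulmxA; congr (_ *m _).
rewrite /E8_basis /E8_alpha -scalemxAl -!scalemxAr -[1%:M](map_mx1 intr) -map_mxD.
rewrite -!map_mxM hamming_stable map_mxZ !scalerA; congr (_ *: _).
by rewrite mulVf ?mulr1 // pnatr_eq0.
Qed.

End E8.

Theorem theorem5p3 (R : realType) (l mu : nat)
  (hlmu : (l, mu) \in [:: (96, 8); (120, 8); (128, 8)]%N) :
  exists (n : nat) (U M N : set 'rV[R]_n) (k : nat),
    [/\ even_unimodular U,
        polarization (scale (Num.sqrt 2)^-1 U) M N,
        (2 <= k)%N,
        even_unimodular_of_rank l (polarized_lattice M N k) &
        has_min_norm (polarized_lattice M N k) mu%:R].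
Proof.
have E8R := E8_half_seven_lattice R.
(* From minimum 2 the condition on k reads 8 < 2 k + 4, that is k >= 3. *)
have [W24 hW24] := half_seven_lattice_step (k := 3) (mu := 2) isT isT E8R.
have [W32 hW32] := half_seven_lattice_step (k := 4) (mu := 2) isT isT E8R.
(* From minimum 4 it reads 16 < 4 k + 4, that is k >= 4. *)
move: hlmu; rewrite !inE => /or3P[] /eqP[-> ->].
- have [M [N [evU pol evL minL]]] :=
    half_seven_lattice_polarized (k := 4) (mu := 4) isT isT hW24.
  by exists (3 * 8)%N, W24, M, N, 4%N.
- have [M [N [evU pol evL minL]]] :=
    half_seven_lattice_polarized (k := 5) (mu := 4) isT isT hW24.
  by exists (3 * 8)%N, W24, M, N, 5%N.
have [M [N [evU pol evL minL]]] :=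
  half_seven_lattice_polarized (k := 4) (mu := 4) isT isT hW32.
by exists (4 * 8)%N, W32, M, N, 4%N.
Qed.
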